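(* Let $\mathcal H_N$ be an $N$-dimensional Hilbert space and let $\{\varphi_i\}_{i=1}^M$ be a unit norm tight frame for $\mathcal H_N$ which has the restricted isometry property with constant $0<\epsilon<1$ for sets of size $s\le N$. Let $\{I_j\}_{j=1}^K$ be any partition of $\{1,2,\ldots,M\}$ with $|I_j|\le \frac s2$ for all $j$, and let $W_j=\operatorname{span}\{\varphi_i: i\in I_j\}$. Then $\{(W_j,1)\}_{j=1}^K$ is an $\epsilon$-nearly tight fusion frame for $\mathcal H_N$ with fusion frame bounds \[ \frac{M}{(1+\epsilon)N},\qquad \frac{M(1+\epsilon)}{N}. \] Moreover, this fusion frame is $2\epsilon(1+\epsilon)^2$-nearly orthogonal, and hence its family of subspaces $\{W_j\}_{j=1}^K$ is $2\epsilon(1+\epsilon)^2$-nearly equi-isoclinic.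
   Context: $\mathcal H_N$ denotes an $N$-dimensional (real or complex) Hilbert space. A family $\{\varphi_i\}_{i=1}^M$ in $\mathcal H_N$ is a unit norm tight frame if $\|\varphi_i\|=1$ for all $i$ and there is a constant $A>0$ with $\sum_{i=1}^M|\langle\varphi,\varphi_i\rangle|^2=A\|\varphi\|^2$ for all $\varphi\in\mathcal H_N$. A finite family $\{\varphi_i\}_{i\in I}$ is an $\epsilon$-Riesz basis for its span if for all scalars $\{a_i\}_{i\in I}$, \[\frac1{1+\epsilon}\sum_{i\in I}|a_i|^2\le\Big\|\sum_{i\in I}a_i\varphi_i\Big\|^2\le(1+\epsilon)\sum_{i\in I}|a_i|^2.\] A family $\{\varphi_i\}_{i=1}^M$ in $\mathcal H_N$ has the restricted isometry property with constant $0<\epsilon<1$ for sets of size $s\le N$ if for every $I\subset\{1,\ldots,M\}$ with $|I|\le s$, the family $\{\varphi_i\}_{i\in I}$ is an $\epsilon$-Riesz basis for its span. A collection of weighted subspaces $\{(W_j,v_j)\}_{j=1}^K$ with weights $v_j>0$ is a fusion frame for $\mathcal H_N$ with fusion frame bounds $0<A\le B<\infty$ if $A\|\varphi\|^2\le\sum_{j=1}^K v_j^2\|P_j\varphi\|^2\le B\|\varphi\|^2$ for all $\varphi\in\mathcal H_N$, where $P_j$ is the orthogonal projection onto $W_j$. It is $\epsilon$-nearly tight if there is a constant $C$ such that the bounds can be taken to be $A=\frac1{1+\epsilon}C$, $B=(1+\epsilon)C$. For $\delta>0$, a fusion frame $\{(W_j,v_j)\}_{j=1}^K$ is $\delta$-nearly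 orthogonal if $|\langle\varphi,\psi\rangle|<\delta$ for all unit vectors $\varphi\in W_i$, $\psi\in W_j$ with $1\le i\ne j\le K$. A family of subspaces $\{W_j\}_{j=1}^K$ with orthogonal projections $P_j$ is $\delta$-nearly equi-isoclinic if there exists $\lambda\ge0$ such that for all $i\neq j$, \[(\lambda-\delta^2)P_i\le P_iP_jP_i\le(\lambda+\delta^2)P_i\quad\text{and}\quad(\lambda-\delta^2)P_j\le P_jP_iP_j\le(\lambda+\delta^2)P_j\] (in the order of self-adjoint operators). *)

(* Defs.v *)
From HB Require Import structures.
From mathcomp Require Import all_boot all_order all_algebra.
From mathcomp Require Import reals complex.

Set Implicit Arguments.
Unset Strict Implicit.
Unset Printing Implicit Defensive.

Import Order.TTheory GRing.Theory Num.Theory.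
Local Open Scope ring_scope.

Variant scalar_kind := RealScalars | ComplexScalars.

Definition scalars (R : realType) (k : scalar_kind) : numFieldType :=
  match k with RealScalars => R : numFieldType
             | ComplexScalars => R[i] : numFieldType end.

Definition scalar_conj (R : realType) (k : scalar_kind) :
    {rmorphism scalars R k -> scalars R k} :=
  match k with RealScalars => idfun : {rmorphism R -> R}
             | ComplexScalars => Num.conj : {rmorphism R[i] -> R[i]} end.

(* Real constants (epsilon, frame bounds, weights, ...) are taken in F itself.
   On R[i] the order is the partial one, x <= y iff y - x is a nonnegative real
   number, so the inequalities below force these constants to be real. *)
Section FusionFrames.
Variables (F : numFieldType) (theta : {rmorphism F -> F}).
Variables (H : vectType F) (dot : {dot H for theta}).

Definition sqnorm (x : H) : F := dot x x.

Definition unit_norm_tight_frame (M : nat) (phi : 'I_M -> H) : Prop :=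
  (forall i, sqnorm (phi i) = 1) /\
  exists2 A : F, 0 < A &
    forall x, \sum_(i < M) `|dot x (phi i)| ^+ 2 = A * sqnorm x.

Definition eps_riesz_basis (M : nat) (phi : 'I_M -> H) (J : {set 'I_M})
    (eps : F) : Prop :=
  forall a : 'I_M -> F,
    (1 + eps)^-1 * (\sum_(i in J) `|a i| ^+ 2)
      <= sqnorm (\sum_(i in J) a i *: phi i)
      <= (1 + eps) * (\sum_(i in J) `|a i| ^+ 2).

Definition restricted_isometry (M : nat) (phi : 'I_M -> H) (eps : F)
    (s : nat) : Prop :=
  [/\ 0 < eps < 1, (s <= \dim {:H})%N &
    forall J : {set 'I_M}, (#|J| <= s)%N -> eps_riesz_basis phi J eps].

Definition ortho_proj (W : {vspace H}) : 'End(H) := daddv_pi W (orthov dot W).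

Definition fusion_frame (K : nat) (W : 'I_K -> {vspace H}) (v : 'I_K -> F)
    (A B : F) : Prop :=
  [/\ forall j, 0 < v j, 0 < A, A <= B &
    forall x, A * sqnorm x
                <= \sum_(j < K) v j ^+ 2 * sqnorm (ortho_proj (W j) x)
                <= B * sqnorm x].

Definition nearly_tight (K : nat) (W : 'I_K -> {vspace H}) (v : 'I_K -> F)
    (eps : F) : Prop :=
  exists C : F, fusion_frame W v ((1 + eps)^-1 * C) ((1 + eps) * C).

Definition nearly_orthogonal (K : nat) (W : 'I_K -> {vspace H})
    (delta : F) : Prop :=
  0 < delta /\
  forall i j, i != j -> forall x y, x \in W i -> y \in W j ->
    sqnorm x = 1 -> sqnorm y = 1 -> `|dot x y| < delta.

(* Loewner order; only used on self-adjoint operators. *)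
Definition op_le (S T : 'End(H)) : Prop := forall x, dot (S x) x <= dot (T x) x.

Definition nearly_equi_isoclinic (K : nat) (W : 'I_K -> {vspace H})
    (delta : F) : Prop :=
  exists2 lambda : F, 0 <= lambda & forall i j, i != j ->
    let P := ortho_proj (W i) in let Q := ortho_proj (W j) in
    [/\ op_le ((lambda - delta ^+ 2) *: P) (P \o Q \o P)%VF,
        op_le (P \o Q \o P)%VF ((lambda + delta ^+ 2) *: P),
        op_le ((lambda - delta ^+ 2) *: Q) (Q \o P \o Q)%VF &
        op_le (Q \o P \o Q)%VF ((lambda + delta ^+ 2) *: Q)].

End FusionFrames.

(* Injectivity makes the blocks I j with distinct indices disjoint; blocks are
   nonempty by [partition]. *)
Definition partition_family (M K : nat) (I : 'I_K -> {set 'I_M}) : Prop :=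
  injective I /\ partition [set I j | j : 'I_K] [set: 'I_M].

(* Main.v *)
Require Import Defs.
From HB Require Import structures.
From mathcomp Require Import all_boot all_order all_algebra.
From mathcomp Require Import reals complex.
From mathcomp Require Import ring.

Set Implicit Arguments.
Unset Strict Implicit.
Unset Printing Implicit Defensive.

Import Order.TTheory GRing.Theory Num.Theory.
Local Open Scope ring_scope.

(** Three facts carry the theorem.

    First, a family that satisfies the upper and lower Riesz inequalities is
    a frame for its span with the same constants [riesz_frame].  Each of the
    two bounds follows by expanding a nonnegative square: that of the vector
    [proj x - t y], with [y] the frame operator applied to [x], and that of
    the coefficient vector [<x, phi i> - t a i], with [a] the coefficients of
    [proj x]; in both cases [t = (1 + eps)^-1].

    Second, summing these bounds over the blocks of the partition rebuilds
    the frame sum [A |x|^2] of the whole tight family, and [A = M / N]: the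
    frame identity summed over an orthogonal basis, together with Parseval
    for each unit vector [phi i], computes [M] in two ways
    [tight_frame_bound].

    Third, two blocks together have at most [s] elements, so restricted
    isometry also applies to their union.  For [x] and [y] in the spans of
    two disjoint blocks, the Riesz bounds of the blocks control the
    coefficients of [x + z y] by [|x|^2] and [|z y|^2], and the Riesz bound
    of the union then gives
    [|x + z y|^2 <= (1 + eps)^2 (|x|^2 + |z y|^2)] for every scalar [z].
    The cross term is therefore small, and the best [z] gives
    [|<x, y>| <= ((1 + eps)^2 - 1) |x| |y|] [riesz_disjoint_dot].  Since
    [(1 + eps)^2 - 1 = 2 eps + eps^2 < 2 eps (1 + eps)^2], near
    orthogonality follows, and then near equi-isoclinicity with
    [lambda = 0].

    Everything is done with squared norms over an arbitrary field of numbers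
    whose conjugation satisfies [x * theta x = |x|^2].  This treats real and
    complex scalars at once and avoids square roots, hence normalization of
    vectors. *)

(** * Inner products and orthogonal projections *)

Lemma scalar_conj_norm (R : realType) (k : scalar_kind) (x : scalars R k) :
  x * scalar_conj R k x = `|x| ^+ 2.
Proof.
case: k x => x /=; first by rewrite real_normK ?num_real // expr2.
by rewrite -normCK.
Qed.

Section InnerProduct.
Variables (F : numFieldType) (theta : {rmorphism F -> F}).
Hypothesis theta_norm : forall x, x * theta x = `|x| ^+ 2.
Variables (H : vectType F) (dot : {dot H for theta}).
Implicit Types (x y : H) (U V : {vspace H}).

Local Notation "''[' x , y ]" := (dot x y).
Local Notation "''[' x ]" := (sqnorm dot x).

Lemma dotC x y : '[x, y] = theta '[y, x].
Proof. by rewrite hermC mul1r. Qed.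

Lemma dotZl a x y : '[a *: x, y] = a * '[x, y].
Proof. by rewrite linearZl_LR. Qed.

Lemma dotZr a x y : '[x, a *: y] = theta a * '[x, y].
Proof. by rewrite linearZr_LR. Qed.

Lemma sqnorm_gt0 x : x != 0 -> 0 < '[x].
Proof. exact: neq0_dnorm_gt0. Qed.

Lemma sqnorm_ge0 x : 0 <= '[x].
Proof.
have [->|/sqnorm_gt0/ltW //] := eqVneq x 0.
by rewrite /sqnorm linear0l.
Qed.

Lemma sqnorm_eq0 x : ('[x] == 0) = (x == 0).
Proof.
have [->|/sqnorm_gt0 x0] := eqVneq x 0; first by rewrite /sqnorm linear0l eqxx.
by rewrite gt_eqF.
Qed.

Lemma theta_pos (t : F) : 0 < t -> theta t = t.
Proof.
move=> t0; have := theta_norm t; rewrite gtr0_norm // expr2.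
by apply: mulfI; rewrite gt_eqF.
Qed.

Lemma theta_sqnorm x : theta '[x] = '[x].
Proof. by rewrite /sqnorm -dotC. Qed.

Lemma dot_normC x y : `|'[x, y]| ^+ 2 = '[x, y] * '[y, x].
Proof. by rewrite -theta_norm -dotC. Qed.

Lemma sqnormD x y : '[x + y] = '[x] + '[y] + ('[x, y] + '[y, x]).
Proof. by rewrite /sqnorm linearDl !linearDr /=; ring. Qed.

Lemma sqnormZ a x : '[a *: x] = `|a| ^+ 2 * '[x].
Proof. by rewrite /sqnorm dotZl dotZr mulrA theta_norm. Qed.

(** Gram-Schmidt without normalization: unit vectors would need square roots,
    which a general field of numbers lacks, so the squared norms stay as
    denominators in the expansion. *)
Lemma orthogonal_basis U : exists e : seq H,
  [/\ size e = \dim U, {subset e <= U}, forall u, u \in e -> u != 0 &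
      forall x, x \in U -> x = \sum_(u <- e) ('[x, u] / '[u]) *: u].
Proof.
move: {2}(\dim U) (erefl (\dim U)) => n.
elim: n U => [|n IH] U dimU.
  exists [::]; split=> // x; move/eqP: dimU; rewrite dimv_eq0 => /eqP ->.
  by rewrite memv0 big_nil => /eqP.
pose u := vpick U.
have u0 : u != 0 by rewrite vpick0 -dimv_eq0 dimU.
have q0 : '[u] != 0 by rewrite sqnorm_eq0.
have uU : u \in U by exact: memv_pick.
have uN : u \notin orthov dot U by apply/mem_orthovPn; exists u.
have [|e [se eU e0 eE]] := IH (U :&: orthov dot <[u]>)%VS.
  by rewrite -(eq_dim_orthov1 uN) dimU.
have eu v : v \in e -> '[u, v] = 0.
  move=> /eU; rewrite memv_cap mem_orthov1 => /andP[_ /eqP vu].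
  by rewrite dotC vu rmorph0.
exists (u :: e); split=> /=.
- by rewrite se -(eq_dim_orthov1 uN) dimU.
- move=> v; rewrite inE => /predU1P[-> //|/eU].
  by rewrite memv_cap => /andP[].
- by move=> v; rewrite inE => /predU1P[-> //|/e0].
move=> x xU; rewrite big_cons; set c := _ / _.
have /eE : x - c *: u \in (U :&: orthov dot <[u]>)%VS.
  rewrite memv_cap memvB ?memvZ //= mem_orthov1 linearBl /= dotZl.
  by rewrite divfK // subrr.
rewrite (eq_big_seq (fun v => ('[x, v] / '[v]) *: v)) => [<-|v ve].
  by rewrite addrC subrK.
by rewrite linearBl /= dotZl eu // mulr0 subr0.
Qed.

(** The orthogonal projection is defined as a projection along the orthogonal
    space, so it has its expected properties only once this space is known to
    be a complement; the next two lemmas provide that. *)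
Lemma orthogonal_split U x : exists2 y, y \in U & x - y \in orthov dot U.
Proof.
have [e [_ eU e0 eE]] := orthogonal_basis U.
exists (\sum_(u <- e) ('[x, u] / '[u]) *: u).
  by rewrite big_seq; apply: memv_suml => u ue; rewrite memvZ ?eU.
apply/mem_orthovP => w /eE wE; rewrite linearBl /= [in X in X - _]wE.
rewrite linear_sumr linear_sumlz; apply/eqP; rewrite subr_eq0; apply/eqP.
apply: eq_bigr => u _ /=; rewrite dotZl dotZr rmorphM fmorphV theta_sqnorm.
by rewrite -dotC; ring.
Qed.

Lemma orthov_cap U : (U :&: orthov dot U = 0)%VS.
Proof.
apply/eqP; rewrite -subv0; apply/subvP => x; rewrite memv_cap memv0.
by case/andP=> xU /mem_orthovP/(_ _ xU)/eqP; rewrite -sqnorm_eq0.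
Qed.

Local Notation proj := (ortho_proj dot).

Lemma ortho_proj_mem U x : proj U x \in U.
Proof. exact: memv_pi. Qed.

Lemma dot_ortho_proj U x y : y \in U -> '[proj U x, y] = '[x, y].
Proof.
move=> yU; have [z zU xzU] := orthogonal_split U x.
have xE : x \in (U + orthov dot U)%VS.
  by rewrite -(subrK z x) addrC memv_add.
rewrite -[x in RHS](daddv_pi_add (orthov_cap U) xE) linearDl /=.
by rewrite (mem_orthovP (memv_pi (orthov dot U) U x)) // addr0.
Qed.

Lemma dot_ortho_proj_id U x : '[proj U x, x] = '[proj U x].
Proof.
rewrite dotC -(@dot_ortho_proj U x) ?ortho_proj_mem // -dotC.
by rewrite /sqnorm.
Qed.

(** * Frames and Riesz families *)

(** Parseval for the unit vector [phi i] writes [1] as the sum over an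
    orthogonal basis of [|<u, phi i>|^2 / |u|^2].  Summing over [i] first,
    each basis vector [u] contributes [A]. *)
Lemma tight_frame_bound M (phi : 'I_M -> H) (A : F) :
    (forall i, '[phi i] = 1) ->
    (forall x, \sum_(i < M) `|'[x, phi i]| ^+ 2 = A * '[x]) ->
  M%:R = A * (\dim {:H})%:R.
Proof.
move=> phi1 phiA; have [e [se _ e0 eE]] := orthogonal_basis fullv.
have parseval i : 1 = \sum_(u <- e) `|'[u, phi i]| ^+ 2 / '[u].
  rewrite -(phi1 i) /sqnorm {1}(eE (phi i) (memvf _)) linear_sumlz.
  by apply: eq_bigr => u _ /=; rewrite dotZl dot_normC; ring.
rewrite -[M]card_ord -sum1_card natr_sum.
under eq_bigr => i _ do rewrite [1%:R](parseval i).
rewrite exchange_big /= (eq_big_seq (fun=> A)) => [|u /e0 u0].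
  by rewrite big_const_seq count_predT iter_addr_0 se mulr_natr.
by rewrite -mulr_suml phiA mulfK // sqnorm_eq0.
Qed.

Lemma span_familyP M (phi : 'I_M -> H) (J : {set 'I_M}) x :
  x \in <<[seq phi i | i in J]>>%VS ->
  exists a : 'I_M -> F, x = \sum_(i in J) a i *: phi i.
Proof.
rewrite span_def big_image => /memv_sumP[v vP ->].
suff /fin_all_exists[a aP] : forall i, exists a, i \in J -> v i = a *: phi i.
  by exists a; apply: eq_bigr.
move=> i; case: (boolP (i \in J)) => [/vP /vlineP[a ->]|_]; last by exists 0.
by exists a.
Qed.

Section Riesz.
Variables (M : nat) (phi : 'I_M -> H) (J : {set 'I_M}) (eps : F).
Hypotheses (eps_gt0 : 0 < eps) (riesz : eps_riesz_basis dot phi J eps).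

Let W : {vspace H} := <<[seq phi i | i in J]>>%VS.

Lemma eps1_gt0 : 0 < 1 + eps. Proof. by rewrite addr_gt0. Qed.

Lemma riesz_coef x : x \in W -> exists2 a : 'I_M -> F,
  x = \sum_(i in J) a i *: phi i &
  \sum_(i in J) `|a i| ^+ 2 <= (1 + eps) * '[x].
Proof.
move=> /span_familyP[a ->]; exists a => //.
have /andP[lo _] := riesz a.
by rewrite -ler_pdivrMl ?eps1_gt0.
Qed.

(** Both bounds come from the upper and lower Riesz inequalities crosswise:
    the lower frame bound uses the estimate on the coefficients of the
    projection, the upper one uses the estimate on the norm of a
    combination. *)
Lemma riesz_frame x :
  (1 + eps)^-1 * '[proj W x] <= \sum_(i in J) `|'[x, phi i]| ^+ 2
    <= (1 + eps) * '[proj W x].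
Proof.
set S := \sum_(i in J) _; set p := '[_].
have e1 := eps1_gt0; have e1n : 1 + eps != 0 by rewrite gt_eqF.
pose t := (1 + eps)^-1; have t0 : 0 < t by rewrite invr_gt0.
have phiW i : i \in J -> phi i \in W.
  by move=> iJ; apply: memv_span; apply: image_f.
apply/andP; split.
  have [a pa aS] := riesz_coef (ortho_proj_mem W x).
  have pE : p = \sum_(i in J) a i * theta '[x, phi i].
    rewrite -[p]dot_ortho_proj_id pa linear_sumlz.
    by apply: eq_bigr => i _ /=; rewrite dotZl dotC.
  have pE' : p = \sum_(i in J) theta (a i) * '[x, phi i].
    rewrite -[p]theta_sqnorm -/p pE rmorph_sum; apply: eq_bigr => i _.
    by rewrite rmorphM /= -dotC -dotC.
  (* The optimal t for the bound |a|^2 <= (1 + eps) p. *)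
  have : 0 <= \sum_(i in J) `|'[x, phi i] - t * a i| ^+ 2.
    by apply: sumr_ge0 => i _; rewrite exprn_ge0.
  have -> : \sum_(i in J) `|'[x, phi i] - t * a i| ^+ 2 =
      S - t * p - t * p + t ^+ 2 * \sum_(i in J) `|a i| ^+ 2.
    rewrite {1}pE pE' !mulr_sumr -!sumrB -big_split /=.
    apply: eq_bigr => i _; rewrite -!theta_norm rmorphB rmorphM (theta_pos t0).
    by ring.
  move=> ge0; rewrite -subr_ge0; apply: le_trans ge0 _.
  have {2}-> : S - t * p = S - t * p - t * p + t ^+ 2 * ((1 + eps) * p).
    by rewrite /t; field.
  by rewrite lerD2l ler_pM2l // exprn_gt0.
(* The frame operator of the block at x: its pairing with x, hence also with
   the projection of x, is S. *)
pose y := \sum_(i in J) '[x, phi i] *: phi i.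
have py : '[proj W x, y] = S.
  rewrite linear_sumr; apply: eq_bigr => i iJ /=.
  by rewrite dotZr dot_ortho_proj ?phiW // mulrC theta_norm.
have yp : '[y, proj W x] = S.
  rewrite linear_sumlz; apply: eq_bigr => i iJ /=.
  by rewrite dotZl [X in _ * X]dotC dot_ortho_proj ?phiW // theta_norm.
have : 0 <= '[proj W x + (- t) *: y] by exact: sqnorm_ge0.
rewrite sqnormD dotZr dotZl py yp rmorphN (theta_pos t0) sqnormZ normrN.
rewrite (gtr0_norm t0) -/p => ge0.
rewrite -ler_pdivrMl // -subr_ge0; apply: le_trans ge0 _.
have -> : p - t * S = p + t ^+ 2 * ((1 + eps) * S) + (- t * S + - t * S).
  by rewrite /t; field.
rewrite lerD2r lerD2l ler_pM2l ?exprn_gt0 //.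
by have /andP[] := riesz (fun i => '[x, phi i]).
Qed.

End Riesz.

(** The Riesz bound of the union controls [|x + z y|^2] for every scalar [z].
    Aligning the phase of [z] with [<x, y>] and optimizing its modulus turns
    this family of bounds into a Cauchy-Schwarz inequality with a small
    constant. *)
Lemma riesz_disjoint_dot M (phi : 'I_M -> H) (J1 J2 : {set 'I_M}) (eps : F) :
    0 < eps -> [disjoint J1 & J2] ->
    eps_riesz_basis dot phi J1 eps -> eps_riesz_basis dot phi J2 eps ->
    eps_riesz_basis dot phi (J1 :|: J2) eps ->
  forall x y, x \in <<[seq phi i | i in J1]>>%VS ->
    y \in <<[seq phi i | i in J2]>>%VS ->
    `|'[x, y]| ^+ 2 <= ((1 + eps) ^+ 2 - 1) ^+ 2 * ('[x] * '[y]).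
Proof.
move=> eps0 dJ r1 r2 r12 x y x1 y2.
have e1 := eps1_gt0 eps0.
set c := (1 + eps) ^+ 2 - 1.
have c0 : 0 < c.
  by rewrite subr_gt0 exprn_egt1 // ltrDl.
have [->|y0] := eqVneq y 0.
  rewrite linear0r normr0 expr0n mulr_ge0 ?exprn_ge0 ?(ltW c0) //.
  by rewrite mulr_ge0 ?sqnorm_ge0.
have q0 := sqnorm_gt0 y0.
set d := '[x, y]; set p := '[x]; set q := '[y].
have cq0 : 0 < c * q by rewrite mulr_gt0.
pose t := (c * q)^-1; have t0 : 0 < t by rewrite invr_gt0.
have [a xa aS] := riesz_coef eps0 r1 x1.
have [b yb bS] := riesz_coef eps0 r2 y2.
(* With z a multiple of d, both cross terms become t |d|^2; the value of t
   minimizes c t^2 q - 2 t. *)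
pose z := t * d.
pose g i := if i \in J1 then a i else z * b i.
have sumJ (V : nmodType) (h : F -> 'I_M -> V) :
    \sum_(i in J1 :|: J2) h (g i) i =
    \sum_(i in J1) h (a i) i + \sum_(i in J2) h (z * b i) i.
  under eq_bigl => i do rewrite in_setU.
  rewrite (@bigU _ _ _ _ (mem J1) (mem J2)) //=; congr (_ + _).
    by apply: eq_bigr => i iJ; rewrite /g iJ.
  by apply: eq_bigr => i iJ; rewrite /g (disjointFl dJ).
have /andP[_] := r12 g.
rewrite (sumJ _ (fun s i => s *: phi i)) (sumJ _ (fun s i => `|s| ^+ 2)).
under [X in sqnorm _ (_ + X)]eq_bigr => i _ do rewrite -scalerA.
under [X in _ <= _ * (_ + X)]eq_bigr => i _ do rewrite normrM exprMn.
rewrite -scaler_sumr -mulr_sumr -xa -yb sqnormD sqnormZ dotZl dotZr -/d -/p -/q.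
have zd : theta z * d = t * `|d| ^+ 2.
  by rewrite /z rmorphM (theta_pos t0) -theta_norm; ring.
have zd' : z * '[y, x] = t * `|d| ^+ 2.
  by rewrite /z -mulrA (dotC y) theta_norm.
have z2 : `|z| ^+ 2 = t ^+ 2 * `|d| ^+ 2.
  by rewrite /z normrM (gtr0_norm t0) exprMn.
rewrite zd zd' z2; set D := `|d| ^+ 2 => le1.
have D0 : 0 <= D by rewrite exprn_ge0.
have {le1} := le_trans le1 (_ : _ <= (1 + eps) *
  ((1 + eps) * p + t ^+ 2 * D * ((1 + eps) * q))).
rewrite ler_pM2l // lerD // ?ler_wpM2l // ?mulr_ge0 ?exprn_ge0 ?(ltW t0) //.
move=> /(_ isT).
rewrite -subr_ge0.
have -> : (1 + eps) * ((1 + eps) * p + t ^+ 2 * D * ((1 + eps) * q)) -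
  (p + t ^+ 2 * D * q + (t * D + t * D)) = t * (c ^+ 2 * (p * q) - D).
  by rewrite /t /c; field; rewrite !gt_eqF.
by rewrite pmulr_rge0 // subr_ge0.
Qed.

(** The quadratic form of [P Q P] at [x] is [|v|^2], where [v = Q P x].  Since
    [|v|^2 = <P x, v>], the bound on the pairing of [U] with [V] gives
    [|v|^4 <= delta^2 |P x|^2 |v|^2].  The summand [0] is the isoclinicity
    parameter. *)
Lemma op_le_proj_comp U V (delta : F) : 0 <= delta ->
    (forall x y, x \in U -> y \in V ->
      `|'[x, y]| ^+ 2 <= delta ^+ 2 * ('[x] * '[y])) ->
  op_le dot ((0 - delta ^+ 2) *: proj U) (proj U \o proj V \o proj U)%VF /\
  op_le dot (proj U \o proj V \o proj U)%VF ((0 + delta ^+ 2) *: proj U).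
Proof.
move=> d0 hUV.
suff key x : 0 <= '[(proj U \o proj V \o proj U)%VF x, x]
    <= delta ^+ 2 * '[proj U x].
  split=> x; rewrite scale_lfunE dotZl dot_ortho_proj_id ?sub0r ?add0r.
    have /andP[ge0 _] := key x; apply: le_trans ge0.
    by rewrite mulNr oppr_le0 mulr_ge0 ?sqnorm_ge0 ?exprn_ge0.
  by have /andP[] := key x.
rewrite !comp_lfunE dotC -(@dot_ortho_proj U x) ?ortho_proj_mem //.
set u := proj U x; set v := proj V u.
have -> : theta '[u, proj U v] = '[v].
  by rewrite -dotC dot_ortho_proj ?ortho_proj_mem // dot_ortho_proj_id.
rewrite sqnorm_ge0 /=.
have [->|v0] := eqVneq v 0.
  by rewrite /sqnorm linear0l mulr_ge0 ?exprn_ge0 ?(sqnorm_ge0 u).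
have := hUV u v (ortho_proj_mem _ _) (ortho_proj_mem _ _).
have -> : '[u, v] = '[v] by rewrite dotC dot_ortho_proj_id theta_sqnorm.
rewrite ger0_norm ?sqnorm_ge0 // expr2 mulrA.
by rewrite ler_pM2r // sqnorm_gt0.
Qed.

End InnerProduct.

(** * The fusion frame of a partition *)

Lemma partition_family_sum (V : nmodType) M K (I : 'I_K -> {set 'I_M})
    (f : 'I_M -> V) :
  partition_family I -> \sum_(j < K) \sum_(i in I j) f i = \sum_i f i.
Proof.
move=> [injI partI].
rewrite [RHS](eq_bigl [in [set: 'I_M]]) => [|i]; last by rewrite inE.
rewrite (set_partition_big _ partI) /= big_imset //.
by move=> i j _ _; apply: injI.
Qed.

Lemma partition_family_disjoint M K (I : 'I_K -> {set 'I_M}) j1 j2 :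
  partition_family I -> j1 != j2 -> [disjoint I j1 & I j2].
Proof.
move=> [injI /and3P[_ /trivIsetP trivI _]] j12.
by apply: trivI; rewrite ?imset_f // (inj_eq injI).
Qed.

Theorem theorem5p5 (R : realType) (k : scalar_kind)
  (H : vectType (scalars R k)) (dot : {dot H for scalar_conj R k})
  (N : nat) (hN : (0 < N)%N) (hH : \dim {:H} = N)
  (M : nat) (phi : 'I_M -> H) (hphi : unit_norm_tight_frame dot phi)
  (eps : scalars R k) (s : nat) (hrip : restricted_isometry dot phi eps s)
  (K : nat) (I : 'I_K -> {set 'I_M}) (hI : partition_family I)
  (hcard : forall j, (2 * #|I j| <= s)%N)
  (W : 'I_K -> {vspace H})
  (hW : forall j, W j = <<[seq phi i | i in I j]>>%VS) :
  [/\ fusion_frame dot W (fun=> 1)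
        (M%:R / ((1 + eps) * N%:R)) (M%:R * (1 + eps) / N%:R),
      nearly_tight dot W (fun=> 1) eps,
      nearly_orthogonal dot W (2 * eps * (1 + eps) ^+ 2) &
      nearly_equi_isoclinic dot W (2 * eps * (1 + eps) ^+ 2)].
Proof.
have thetaN := @scalar_conj_norm R k.
case: hphi => phi1 [A A0 phiA]; case: hrip => /andP[eps0 _] _ rip.
have e1 := eps1_gt0 eps0; have e1n : 1 + eps != 0 by rewrite gt_eqF.
have rI j : eps_riesz_basis dot phi (I j) eps.
  by apply: rip; apply: leq_trans (hcard j); rewrite leq_pmull.
have Nn0 : N%:R != 0 :> scalars R k by rewrite pnatr_eq0 -lt0n.
have AE : A = M%:R / N%:R.
  by rewrite (tight_frame_bound thetaN phi1 phiA) hH mulfK.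
have frame : fusion_frame dot W (fun=> 1) ((1 + eps)^-1 * A) ((1 + eps) * A).
  split=> [j||| x] //; first by rewrite mulr_gt0 ?invr_gt0.
    rewrite ler_pM2r //; apply: (@le_trans _ _ 1); last by rewrite lerDl ltW.
    by rewrite invf_le1 // lerDl ltW.
  rewrite -!mulrA -phiA -(partition_family_sum _ hI).
  under [X in _ <= X <= _]eq_bigr => j _ do rewrite expr1n mul1r hW.
  rewrite !mulr_sumr; apply/andP; split; apply: ler_sum => j _;
    have /andP[lo hi] := riesz_frame thetaN eps0 (rI j) x.
    by rewrite ler_pdivrMl.
  by rewrite -ler_pdivrMl.
set delta := 2 * eps * (1 + eps) ^+ 2.
have delta0 : 0 < delta by rewrite !mulr_gt0 // exprn_gt0.
set c := (1 + eps) ^+ 2 - 1.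
have c0 : 0 < c by rewrite subr_gt0 exprn_egt1 // ltrDl.
have cdelta : c < delta.
  rewrite -subr_gt0.
  have -> : delta - c = 3 * eps ^+ 2 + 2 * eps ^+ 3 by rewrite /delta /c; ring.
  by rewrite addr_gt0 // mulr_gt0 // exprn_gt0.
have ortho i j : i != j -> forall x y, x \in W i -> y \in W j ->
    `|dot x y| ^+ 2 <= c ^+ 2 * (sqnorm dot x * sqnorm dot y).
  move=> ij x y; rewrite !hW; apply: riesz_disjoint_dot => //.
    exact: partition_family_disjoint ij.
  apply: rip; apply: leq_trans (leq_card_setU _ _) _.
  rewrite -(leq_pmul2l (isT : (0 < 2)%N)) mulnDr [(2 * s)%N]mul2n -addnn.
  by rewrite leq_add.
split.
- have -> : M%:R / ((1 + eps) * N%:R) = (1 + eps)^-1 * A.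
    by rewrite AE invfM mulrCA.
  have -> : M%:R * (1 + eps) / N%:R = (1 + eps) * A by rewrite AE mulrAC mulrC.
  exact: frame.
- by exists A.
- split=> // i j ij x y xi yj x1 y1; apply: le_lt_trans cdelta.
  have := ortho i j ij x y xi yj; rewrite x1 y1 !mulr1.
  by rewrite ler_pXn2r ?nnegrE // ltW.
- exists 0 => // i j ij P Q.
  have {}ortho a b : a != b -> forall x y, x \in W a -> y \in W b ->
      `|dot x y| ^+ 2 <= delta ^+ 2 * (sqnorm dot x * sqnorm dot y).
    move=> ab x y xa yb; apply: le_trans (ortho a b ab x y xa yb) _.
    by rewrite ler_wpM2r ?mulr_ge0 ?sqnorm_ge0 // ler_pXn2r ?nnegrE ?ltW.
  have [? ?] := op_le_proj_comp (ltW delta0) (ortho i j ij).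
  have ji : j != i by rewrite eq_sym.
  by have [? ?] := op_le_proj_comp (ltW delta0) (ortho j i ji).
Qed.
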